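(* For every positive integer $n$, the $n$-th Bell number is $$B_n=\sum_{(\lambda_1,\dots,\lambda_m)\vDash n}\frac{(n-1)!}{\prod_{i=1}^{m-1}\Big(n-\sum_{j=1}^{i}\lambda_j\Big)\cdot\prod_{k=1}^{m}(\lambda_k-1)!},$$ where the sum runs over all compositions $(\lambda_1,\dots,\lambda_m)$ of $n$ (all $m\ge1$).
   Context: $B_n$ is the number of set partitions of an $n$-element set. A composition of $n$ is a finite sequence of positive integers with sum $n$. Empty products equal $1$. *)

(* Defs.v *)
From HB Require Import structures.
From mathcomp Require Import all_boot all_order all_algebra.

Set Implicit Arguments.
Unset Strict Implicit.
Unset Printing Implicit Defensive.

Definition bell (n : nat) : nat :=
  #|[set P : {set {set 'I_n}} | partition P [set: 'I_n]]|.

Definition is_composition (n : nat) (s : seq nat) : bool :=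
  all (fun k => 0 < k) s && (sumn s == n).

Record composition (n : nat) : Type := Composition {
  parts :> seq nat;
  _ : is_composition n parts
}.

HB.instance Definition _ n := [isSub for @parts n].
HB.instance Definition _ n := [Countable of composition n by <:].

Lemma composition_size n (c : composition n) : size c <= n.
Proof.
case: c => s /= /andP[s_gt0 /eqP <-]; elim: s s_gt0 => //= k s IHs.
by case/andP=> k_gt0 /IHs; rewrite -add1n; apply: leq_add.
Qed.

Lemma composition_part_le n (c : composition n) k : k \in parts c -> k <= n.
Proof.
case: c => s /= /andP[_ /eqP <-]; elim: s => //= a s IHs.
rewrite inE => /predU1P[->|/IHs k_le]; first exact: leq_addr.
exact: leq_trans k_le (leq_addl _ _).
Qed.

(* At most n parts, each at most n: compositions embed in a finite type of
   bounded sequences, which gives the finType structure on composition n. *)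
Definition bseq_of_composition n (c : composition n) : n.-bseq 'I_n.+1 :=
  insub_bseq n (map inord c).

Definition composition_of_bseq n (b : n.-bseq 'I_n.+1) : option (composition n) :=
  insub (map val b).

Lemma bseq_of_compositionK n :
  pcancel (@bseq_of_composition n) (@composition_of_bseq n).
Proof.
move=> c; rewrite /composition_of_bseq /bseq_of_composition /insub_bseq val_insubd.
rewrite size_map composition_size -map_comp.
rewrite (_ : map _ _ = parts c) ?valK //; rewrite -[RHS]map_id.
apply/eq_in_map => k /composition_part_le k_le /=.
by rewrite inordK.
Qed.

HB.instance Definition _ n :=
  isFinite.Build (composition n) (pcan_enumP (@bseq_of_compositionK n)).

(* Main.v *)
(** Both sides satisfy [B (n+1) = \sum_(k <= n) 'C(n, k) B k].  For set
    partitions, [k] is the number of points outside the block of a fixed point;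
    for compositions, [k] is the sum of all parts but the first, and deleting
    the first part divides the summand by exactly ['C(n, k)]. *)
Require Import Defs.
From mathcomp Require Import all_boot all_order all_algebra ring.

Set Implicit Arguments.
Unset Strict Implicit.
Unset Printing Implicit Defensive.

Import GRing.Theory Num.Theory.

(** Sort the partitions by the complement [C] in [D] of the block of [x]. Removing that block leaves
    a partition of [C]; the inverse adds the block [D :\: C]. *)
Lemma card_partitions_pblock (T : finType) (D : {set T}) (x : T) :
  x \in D ->
  #|[set P | partition P D]| =
  \sum_(C : {set T} | C \subset D :\ x) #|[set P | partition P C]|.
Proof.
move=> Dx; rewrite -sum1_card.
rewrite (partition_big (fun P => D :\: pblock P x)
                       (fun C : {set T} => C \subset D :\ x)) /=; last first.
  move=> P; rewrite inE => partP; apply/setDS; rewrite sub1set mem_pblock.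
  by rewrite (cover_partition partP).
apply: eq_bigr => C; rewrite subsetD1 => /andP[CD Cx].
have Bx : x \in D :\: C by rewrite inE Cx.
have disC : [disjoint D :\: C & C] by rewrite -setI_eq0 setIDAC setDIl setDv setI0.
(* The new block contains [x], which lies outside [C]; this makes adding it injective in [Q]. *)
have notBQ Q : partition Q C -> D :\: C \notin Q.
  by move=> partQ; apply: contra Cx => /(partitionS partQ)/subsetP; apply.
rewrite sum1_card -[RHS](card_in_imset (f := fun Q => (D :\: C) |: Q)); last first.
  move=> Q1 Q2; rewrite !inE => /notBQ Q1B /notBQ Q2B eqQ.
  by rewrite -(setU1K Q1B) eqQ setU1K.
apply: eq_card => P; rewrite unfold_in.
apply/andP/imsetP => [[]|[Q]]; rewrite inE.
  move=> partP /eqP defC; have covP := cover_partition partP.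
  have Px : pblock P x \in P by rewrite pblock_mem ?covP.
  have defB : D :\: C = pblock P x.
    by rewrite -defC setDDr setDv set0U; apply/setIidPr/(partitionS partP).
  exists (P :\ pblock P x); last by rewrite defB setD1K.
  by rewrite inE -defC partitionD1.
move=> partQ ->.
have partP : partition ((D :\: C) |: Q) D.
  rewrite -{2}(setID D C) (setIidPr CD) [C :|: _]setUC.
  by apply: partitionU1 => //; apply/set0Pn; exists x.
split; first by rewrite inE.
rewrite (def_pblock (partition_trivIset partP) (setU11 _ _) Bx).
by rewrite setDDr setDv set0U; apply/eqP/setIidPr.
Qed.

Local Open Scope ring_scope.

Lemma sum_subsets_by_card (R : pzSemiRingType) (T : finType) (D : {set T})
    (f : nat -> R) :
  \sum_(C : {set T} | C \subset D) f #|C| =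
  \sum_(k < #|D|.+1) 'C(#|D|, k)%:R * f k.
Proof.
rewrite (partition_big (fun C : {set T} => inord #|C| : 'I_#|D|.+1) predT) //=.
apply: eq_bigr => k _; rewrite -cards_draws mulr_natl -sumr_const.
apply: congr_big => // [C|C].
  rewrite inE; have [CD|//] := boolP (C \subset D).
  by rewrite -val_eqE /= inordK // ltnS subset_leq_card.
by case/andP=> CD /eqP <-; rewrite inordK // ltnS subset_leq_card.
Qed.

Definition composition_weight (n : nat) (s : seq nat) : rat :=
  ((n.-1)`!)%:R /
  (\prod_(1 <= i < size s) (n%:R - \sum_(1 <= j < i.+1) (nth 0%N s j.-1)%:R)
   * \prod_(1 <= k < (size s).+1) ((nth 0%N s k.-1).-1`!)%:R).

(** The first difference in the denominator is n+1 - (n+1-k) = k, and the later ones are those of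
    [s] with total [k]. The first part contributes (n-k)!, and n! = C(n,k) k! (n-k)! with k!/k =
    (k-1)! does the rest. *)
Lemma composition_weight_cons (n k : nat) (s : seq nat) :
  (k <= n)%N -> is_composition k s ->
  composition_weight n.+1 ((n.+1 - k)%N :: s) =
  'C(n, k)%:R * composition_weight k s.
Proof.
have fact_neq0 m : m`!%:R != 0 :> rat by rewrite pnatr_eq0 -lt0n fact_gt0.
case: s => [|a s] kn /andP[/= s_gt0 /eqP defk]; rewrite /composition_weight.
  (* Here k = 0: the single part n+1 gives no difference factor, so no k needs cancelling. *)
  rewrite -defk /= subn0 big_nat1 !big_geq //= bin0 !mul1r.
  by rewrite divff // divr1.
have k_gt0 : (0 < k)%N by rewrite -defk addn_gt0; case/andP: s_gt0 => ->.
set t := a :: s; set m := (n.+1 - k)%N.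
have mE : m%:R = n.+1%:R - k%:R :> rat by rewrite natrB // (leq_trans kn).
have -> : \prod_(1 <= i < size (m :: t))
      (n.+1%:R - \sum_(1 <= j < i.+1) (nth 0%N (m :: t) j.-1)%:R) =
    k%:R * \prod_(1 <= i < size t)
      (k%:R - \sum_(1 <= j < i.+1) (nth 0%N t j.-1)%:R) :> rat.
  rewrite big_ltn // big_nat1 /= mE subKr big_add1 /=; congr (_ * _).
  apply: eq_big_nat => i /andP[i_gt0 _].
  rewrite big_ltn // big_add1 /= mE opprD addrA subKr; congr (_ - _).
  by apply: eq_big_nat => -[].
have -> : \prod_(1 <= i < (size (m :: t)).+1)
      ((nth 0%N (m :: t) i.-1).-1`!)%:R =
    (n - k)`!%:R * \prod_(1 <= i < (size t).+1)
      ((nth 0%N t i.-1).-1`!)%:R :> rat.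
  rewrite big_ltn // big_add1 /= /m subSn //; congr (_ * _).
  by apply: eq_big_nat => -[].
rewrite -(bin_fact kn) -(prednK k_gt0) factS /= prednK // !natrM.
have k_neq0 : k%:R != 0 :> rat by rewrite pnatr_eq0 -lt0n.
rewrite !invfM.
(* Abstracting the inverses, not the products, spares [field] the proof that the products are
   nonzero. *)
move: (\big[_/_]_(_ <= _ < _) _)^-1 (\big[_/_]_(_ <= _ < _) _)^-1 => A' B'.
by field; rewrite fact_neq0.
Qed.

Lemma is_composition_cons (n k : nat) (s : seq nat) :
  (k <= n)%N -> is_composition k s ->
  is_composition n.+1 ((n.+1 - k)%N :: s).
Proof.
move=> kn /andP[s_gt0 /eqP defk]; rewrite /is_composition /= s_gt0 defk.
by rewrite subn_gt0 ltnS kn subnK ?eqxx // (leq_trans kn).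
Qed.

Lemma sum_composition_recl (R : nmodType) (n : nat) (f : seq nat -> R) :
  \sum_(l : composition n.+1) f l =
  \sum_(k < n.+1) \sum_(l : composition k) f ((n.+1 - k)%N :: l).
Proof.
rewrite (partition_big (fun l : composition n.+1 =>
  inord (sumn (behead l)) : 'I_n.+1) predT) //=.
apply: eq_bigr => k _; have kn : (k <= n)%N by rewrite -ltnS.
pose h (l : composition k) := Composition (is_composition_cons kn (valP l)).
have h_inj : injective h.
  by move=> l1 l2 [eql]; apply: val_inj.
rewrite -[RHS](big_imset (fun l : composition n.+1 => f l) (in2W h_inj)) /=.
apply: eq_bigl => -[s s_comp] /=; apply/eqP/imsetP => [|[l _ [->]]]; last first.
  by case: l => s' /= /andP[_ /eqP ->]; apply: val_inj; rewrite /= inordK ?ltnS.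
case: s s_comp => [|a s] s_comp //=.
have /andP[/= /andP[a_gt0 s_gt0] /eqP sumE] := s_comp.
(* As the first part is positive, the tail sums to at most n, so [inord] does not alter it. *)
have s_le : (sumn s < n.+1)%N by rewrite -sumE -[ltnLHS]add0n ltn_add2r.
move/(congr1 val); rewrite /= inordK // => defk.
have s_compk : is_composition k s by rewrite /is_composition s_gt0 defk eqxx.
exists (Composition s_compk) => //; apply: val_inj => /=.
by rewrite -defk -sumE addnK.
Qed.

Definition weight_sum (n : nat) : rat :=
  \sum_(l : composition n) composition_weight n l.

(** The recurrence descends to k = 0. There the only composition is empty, both products are empty,
    and [0.-1] is 0, so the numerator is 0! = 1. *)
Lemma weight_sum0 : weight_sum 0 = 1.
Proof.
have nil_comp : is_composition 0 [::] by [].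
rewrite /weight_sum (big_pred1 (Composition nil_comp)) => [|l].
  by rewrite /composition_weight /= !big_geq // mulr1 divr1.
apply/esym/eqP/val_inj; have := composition_size l; rewrite leqn0.
by move/nilP.
Qed.

Lemma weight_sumS n :
  weight_sum n.+1 = \sum_(k < n.+1) 'C(n, k)%:R * weight_sum k.
Proof.
rewrite /weight_sum sum_composition_recl; apply: eq_bigr => k _.
rewrite mulr_sumr; apply: eq_bigr => l _.
by rewrite composition_weight_cons ?(valP l) // -ltnS.
Qed.

(** Strong induction on [#|D|]; arbitrary subsets [D] are allowed because the recurrence passes to
    subsets of [D :\ x]. *)
Lemma card_partitionsE (T : finType) (D : {set T}) :
  #|[set P | partition P D]|%:R = weight_sum #|D|.
Proof.
have [n] := ubnP #|D|; elim: n D => // n IHn D.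
have [->|/set0Pn[x Dx]] := eqVneq D set0.
  move=> _; rewrite cards0 weight_sum0.
  have -> : [set P : {set {set T}} | partition P set0] = [set set0].
    by apply/setP => P; rewrite !inE partition_set0.
  by rewrite cards1.
rewrite (cardsD1 x) Dx add1n ltnS => ltDn.
(* The binomial sum is unfolded into a sum over subsets [C], to be compared term by term. *)
rewrite (card_partitions_pblock Dx) weight_sumS -sum_subsets_by_card natr_sum.
apply: eq_bigr => C CD; apply: IHn.
by apply: leq_trans ltDn; rewrite ltnS subset_leq_card.
Qed.

(* The part lambda_j (1-based) is nth 0 lambda (j - 1). *)
Theorem theorem5p4 (n : nat) (n_gt0 : (0 < n)%N) :
  (bell n)%:R =
  \sum_(l : composition n)
     ((n.-1)`!)%:R /
     (\prod_(1 <= i < size l) (n%:R - \sum_(1 <= j < i.+1) (nth 0%N l j.-1)%:R)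
      * \prod_(1 <= k < (size l).+1) ((nth 0%N l k.-1).-1`!)%:R) :> rat.
Proof. by rewrite /bell card_partitionsE cardsT card_ord. Qed.
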